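(* Let $(n,k,r)$ be an admissible triple of parameters, i.e. $n\in\mathbb{N}$, $k\in\{0,\ldots,n\}$, $r\in[0,\infty)$ and $\max\{k,r\}>0$. Then the $r$-Lah distribution $\mathrm{Lah}(n,k)_r$ is log-concave, that is $$\mathbb{P}[\mathrm{Lah}(n,k)_r=i]^2\geq\mathbb{P}[\mathrm{Lah}(n,k)_r=i-1]\,\mathbb{P}[\mathrm{Lah}(n,k)_r=i+1]$$ for all $i\in\{k+1,\ldots,n-1\}$.
   Context: $\mathbb{N}=\{1,2,\ldots\}$, $\mathbb{N}_0=\mathbb{N}\cup\{0\}$. Let $\genfrac{[}{]}{0pt}{}{n}{k}$ and $\genfrac{\{}{\}}{0pt}{}{n}{k}$ be the (unsigned) Stirling numbers of the first kind (number of permutations of $\{1,\dots,n\}$ with exactly $k$ cycles) and of the second kind (number of partitions of $\{1,\dots,n\}$ into $k$ non-empty subsets). For $n\in\mathbb{N}_0$, $k\in\{0,\ldots,n\}$ and $r\in\mathbb{R}$ the $r$-Stirling numbers are defined (with $0^0=1$) by $$\genfrac{[}{]}{0pt}{}{n}{k}_r=\sum_{j=k}^n\genfrac{[}{]}{0pt}{}{n}{j}\binom{j}{k}r^{j-k},\qquad \genfrac{\{}{\}}{0pt}{}{n}{k}_r=\sum_{j=k}^n\binom{n}{j}\genfrac{\{}{\}}{0pt}{}{j}{k}r^{n-j}.$$ The $r$-Lah number is $L(n,k)_r=\sum_{j=k}^n\genfrac{[}{]}{0pt}{}{n}{j}_r\genfrac{\{}{\}}{0pt}{}{j}{k}_r$.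 For an admissible triple $(n,k,r)$, $\mathrm{Lah}(n,k)_r$ denotes a random variable with the $r$-Lah distribution $$\mathbb{P}[\mathrm{Lah}(n,k)_r=j]=\frac{1}{L(n,k)_r}\genfrac{[}{]}{0pt}{}{n}{j}_r\genfrac{\{}{\}}{0pt}{}{j}{k}_r,\qquad j\in\{k,k+1,\ldots,n\}.$$ *)

(* Defs.v *)
From HB Require Import structures.
From mathcomp Require Import all_boot all_order all_algebra all_fingroup.
From mathcomp Require Import all_classical all_reals all_analysis.
Set Implicit Arguments.
Unset Strict Implicit.
Unset Printing Implicit Defensive.
Import Order.TTheory GRing.Theory Num.Theory.
Local Open Scope ring_scope.

Definition stirling1 (n k : nat) : nat :=
  #|[set s : 'S_n | #|porbits s| == k]|.

Definition stirling2 (n k : nat) : nat :=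
  #|[set Q : {set {set 'I_n}} | finset.partition Q [set: 'I_n] & #|Q| == k]|.

Definition rstirling1 (R : realType) (r : R) (n k : nat) : R :=
  \sum_(k <= j < n.+1) (stirling1 n j)%:R * 'C(j, k)%:R * r ^+ (j - k).

Definition rstirling2 (R : realType) (r : R) (n k : nat) : R :=
  \sum_(k <= j < n.+1) 'C(n, j)%:R * (stirling2 j k)%:R * r ^+ (n - j).

Definition rlah (R : realType) (r : R) (n k : nat) : R :=
  \sum_(k <= j < n.+1) rstirling1 r n j * rstirling2 r j k.

Definition rlah_admissible (R : realType) (n k : nat) (r : R) : Prop :=
  [/\ (0 < n)%N, (k <= n)%N, 0 <= r & 0 < Num.max k%:R r].

(* The prescribed masses are nonnegative and add up to 1 for an admissible     *)
(* triple, so they determine the law of X; see rlah_distributed_exists.        *)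
Definition rlah_distributed (R : realType) (d : measure_display)
    (T : measurableType d) (P : probability T R) (X : {RV P >-> nat})
    (n k : nat) (r : R) : Prop :=
  forall j : nat, (k <= j <= n)%N ->
    P (X @^-1` [set j])%classic =
      ((rlah r n k)^-1 * (rstirling1 r n j * rstirling2 r j k))%:E.

Lemma stirling1_diag_gt0 (n : nat) : (0 < stirling1 n n)%N.
Proof.
apply/card_gt0P; exists 1%g; rewrite inE.
have -> : porbits (1 : 'S_n)%g = [set [set x] | x : 'I_n].
  apply: eq_imset => x; apply/setP => y; rewrite inE.
  apply/porbitP/eqP => [[i ->]|->]; first by rewrite expg1n perm1.
  by exists 0; rewrite expg0 perm1.
by rewrite card_imset ?card_ord //; exact: set1_inj.
Qed.

Lemma stirling2_gt0 (n k : nat) : (0 < k <= n)%N -> (0 < stirling2 n k)%N.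
Proof.
case: k => // k /= kn; apply/card_gt0P.
pose f (x : 'I_n) : 'I_k.+1 := inord (minn x k).
have fE (x : 'I_n) : f x = minn x k :> nat by rewrite inordK // ltnS geq_minr.
exists (preim_partition f [set: 'I_n]%SET).
rewrite inE preim_partitionP /=.
pose g (z : 'I_k.+1) := [set y : 'I_n | f y == z]%SET.
pose h (z : 'I_k.+1) : 'I_n := Ordinal (leq_trans (ltn_ord z) kn).
have fh z : f (h z) = z.
  by apply: val_inj; rewrite /= fE /=; apply/minn_idPl; rewrite -ltnS.
have -> : preim_partition f [set: 'I_n]%SET = [set g z | z : 'I_k.+1]%SET.
  apply/setP => B; apply/imsetP/imsetP => [[x _ ->]|[z _ ->]].
    by exists (f x) => //; apply/setP => y; rewrite !inE /= eq_sym.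
  by exists (h z) => //; apply/setP => y; rewrite !inE /= fh eq_sym.
rewrite card_imset ?card_ord // => z1 z2 /setP/(_ (h z1)).
by rewrite !inE fh eqxx => /esym/eqP.
Qed.

Lemma stirling200 : (0 < stirling2 0 0)%N.
Proof.
apply/card_gt0P; exists finset.set0; rewrite inE cards0 eqxx andbT.
apply/and3P; split; last by rewrite inE.
  by rewrite /finset.cover big_set0; apply/eqP/setP => -[].
by apply/finset.trivIsetP => A B; rewrite inE.
Qed.

Lemma rstirling1_ge0 (R : realType) (r : R) (n k : nat) :
  0 <= r -> 0 <= rstirling1 r n k.
Proof.
by move=> r0; apply: sumr_ge0 => j _; rewrite !mulr_ge0 // exprn_ge0.
Qed.

Lemma rstirling2_ge0 (R : realType) (r : R) (n k : nat) :
  0 <= r -> 0 <= rstirling2 r n k.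
Proof.
by move=> r0; apply: sumr_ge0 => j _; rewrite !mulr_ge0 // exprn_ge0.
Qed.

Lemma rlah_gt0 (R : realType) (n k : nat) (r : R) :
  rlah_admissible n k r -> 0 < rlah r n k.
Proof.
case=> n0 kn r0 kr0.
rewrite /rlah big_nat_recr //= ltr_wpDl //.
  by apply: sumr_ge0 => j _; rewrite mulr_ge0 // ?rstirling1_ge0 ?rstirling2_ge0.
rewrite mulr_gt0 //.
  rewrite /rstirling1 big_nat1 subnn expr0 binn !mulr1 ltr0n.
  exact: stirling1_diag_gt0.
have [k0|k0] := posnP k.
  have {}r0 : 0 < r by move: kr0; rewrite k0 lt_max ltxx.
  rewrite k0 /rstirling2 big_nat_recl //= ltr_wpDr //.
    by apply: sumr_ge0 => j _; rewrite !mulr_ge0 // exprn_ge0 // ltW.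
  by rewrite bin0 mul1r mulr_gt0 ?exprn_gt0 // ltr0n stirling200.
rewrite /rstirling2 big_nat_recr //= ltr_wpDl //.
  by apply: sumr_ge0 => j _; rewrite !mulr_ge0 // exprn_ge0.
by rewrite subnn expr0 binn mul1r mulr1 ltr0n stirling2_gt0 // k0.
Qed.

Lemma rlah_distributed_exists (R : realType) (n k : nat) (r : R) :
  rlah_admissible n k r ->
  exists (P : probability nat R) (X : {RV P >-> nat}),
    rlah_distributed X n k r.
Proof.
move=> adm; have L0 := rlah_gt0 adm; case: adm => n0 kn r0 _.
pose p j := (rlah r n k)^-1 * (rstirling1 r n j * rstirling2 r j k).
have p0 j : 0 <= p j.
  by rewrite !mulr_ge0 ?invr_ge0 ?(ltW L0) ?rstirling1_ge0 ?rstirling2_ge0.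
pose m : {measure set nat -> \bar R} :=
  msum (fun j => mscale (NngNum (p0 j)) (\d_j : {measure set nat -> \bar R}))
    n.+1.
have mE A : m A = (\sum_(0 <= j < n.+1) p j * \1_A j)%:E.
  rewrite /m /= /msum -(big_mkord xpredT (fun j => mscale (NngNum (p0 j)) \d_j A)).
  rewrite -sumEFin; apply: eq_bigr => j _.
  by rewrite /mscale /= diracE indicE -EFinM.
have mT : m setT = 1%E.
  rewrite mE; congr EFin.
  rewrite (big_cat_nat _ (n := k)) //= ?leqW //.
  rewrite big_nat_cond big1 ?add0r; last first.
    move=> j /andP[/andP[_ jk] _].
    by rewrite /p /rstirling2 big_geq // !mulr0 mul0r.
  under eq_bigr do rewrite indicT mulr1.
  by rewrite -mulr_sumr mulVf // gt_eqF.
pose P : probability nat R := mnormalize m (\d_0%N : probability nat R).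
have PE A : P A = m A.
  rewrite /P /= /mnormalize -/m mT onee_eq0 /=.
  by rewrite invr1 mule1.
have mid : measurable_fun [set: nat] (@id nat) by exact: measurable_id.
pose X : {RV P >-> nat} := HB.pack (@id nat) (isMeasurableFun.Build _ _ _ _ _ mid).
exists P, X => j /andP[kj jn].
rewrite [LHS]PE mE; congr EFin.
have jI : j \in index_iota 0 n.+1 by rewrite mem_index_iota ltnS.
rewrite (bigD1_seq j jI (iota_uniq _ _)) /=.
rewrite indicE mem_set //= mulr1 big1 => [|i ij]; first by rewrite addr0.
by rewrite indicE memNset ?mulr0 //= => ji; rewrite ji eqxx in ij.
Qed.

(* Main.v *)
(** The mass function is, up to a constant, the product of a row of r-Stirling
    numbers of the first kind and a column of r-Stirling numbers of the second
    kind, and each factor is log-concave without internal zeros. The row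
    consists of the coefficients of [\prod_(i < n) ('X + (r + i))], and
    multiplication by ['X + c] with [c >= 0] preserves log-concavity. The
    column [b] of index [k] is obtained from the shifted column [a] of index
    [k - 1] by [b_(j+1) = a_(j+1) + (r + k) b_j], i.e. by convolution with a
    geometric sequence, which preserves log-concavity too. *)

Require Import Defs.
From mathcomp Require Import all_boot all_order all_algebra all_fingroup.
From mathcomp Require Import all_classical all_reals all_analysis.
From mathcomp Require Import lra.
Set Implicit Arguments.
Unset Strict Implicit.
Unset Printing Implicit Defensive.
Import Order.TTheory GRing.Theory Num.Theory.
Local Open Scope ring_scope.

(* Unlike [a i.-1 * a i.+1 <= a i ^+ 2], this condition excludes internal
   zeros, and is preserved by the two operations below. *)
Definition log_concave (R : numDomainType) (a : nat -> R) : Prop :=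
  (forall i, 0 <= a i) /\
  (forall q p, (q <= p)%N -> a q * a p.+1 <= a q.+1 * a p).

(** * Operations that preserve log-concavity *)

Section log_concave_theory.
Variable R : realDomainType.
Implicit Types (a b : nat -> R) (c : R).

(** Each use of log-concavity raises the left index and lowers the right one by one, so [d] uses
    turn the pair [(q, p + d)] into [(q + d, p)]; once the left index reaches [p], both sides agree
    by commutativity. *)
Lemma log_concave_shift a d q p :
  log_concave a -> (q <= p)%N -> a q * a (p + d)%N <= a (q + d)%N * a p.
Proof.
move=> [_ lca]; elim: d q => [|d IH] q qp; first by rewrite !addn0.
move: qp; rewrite leq_eqVlt => /predU1P[->|qp]; first by rewrite mulrC.
rewrite addnS; apply: le_trans (lca _ _ (leq_trans (ltnW qp) (leq_addr _ _))) _.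
by rewrite -addSnnS IH.
Qed.

Lemma log_concave_delay a :
  log_concave a -> log_concave (fun i => if i is j.+1 then a j else 0).
Proof.
move=> [a0 lca]; split=> [[|i]|[|q] [|p]] //=; rewrite ?mul0r ?mulr_ge0 //.
by rewrite ltnS => /lca.
Qed.

Lemma log_concave_affine_mul a b c :
  0 <= c -> log_concave a ->
  (forall i, b i = (if i is j.+1 then a j else 0) + c * a i) ->
  log_concave b.
Proof.
move=> c0 lca bE; have [a0 lca1] := lca.
have [z0 lcz] := log_concave_delay lca.
split=> [i|q p qp]; first by rewrite bE addr_ge0 ?mulr_ge0.
rewrite !bE.
have := lcz _ _ qp; have := lca1 _ _ qp.
(* The two products are compared degree by degree in [c]. In degree 1 the term [a q * a p] cancels,
   which leaves this comparison, a shift by 2. *)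
have : (if q is j.+1 then a j else 0) * a p.+1 <=
       a q.+1 * (if p is j.+1 then a j else 0).
  case: q qp => [|q] qp; first by rewrite mul0r mulr_ge0.
  case: p qp => // p qp; have := @log_concave_shift a 2 q p lca.
  by rewrite !addn2; apply; rewrite -ltnS.
set z := if q is _.+1 then _ else _; set w := if p is _.+1 then _ else _.
move=> h1 h2 h3.
have {}h1 := ler_wpM2l c0 h1; have {}h2 := ler_wpM2l (mulr_ge0 c0 c0) h2.
lra.
Qed.

(** Both [b q * b p.+1] and [b q.+1 * b p] contain [c * b q * b p]; once it cancels,
    [b q * a p.+1 <= a q.+1 * b p] remains. *)
Lemma log_concave_geometric a b c :
  0 <= c -> log_concave a -> b 0%N = a 0%N ->
  (forall i, b i.+1 = a i.+1 + c * b i) -> log_concave b.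
Proof.
move=> c0 lca b00 bS; have [a0 lca1] := lca.
have b0 i : 0 <= b i.
  by elim: i => [|i IH]; rewrite ?b00 // bS addr_ge0 ?mulr_ge0.
have bE i : b i = \sum_(j < i.+1) c ^+ j * a (i - j)%N.
  elim: i => [|i IH]; first by rewrite big_ord1 mul1r.
  rewrite bS IH [RHS]big_ord_recl mul1r mulr_sumr; congr (_ + _).
  by apply: eq_bigr => j _; rewrite mulrA -exprS subSS.
split=> // q p qp.
have : b q * a p.+1 <= a q.+1 * b p; last by rewrite !bS; lra.
(* The sum for [b p] is cut to [q.+1] terms, compared one by one with those of [b q] by a shift of
   [j.+1]; the dropped terms are nonnegative. *)
have : b q * a p.+1 <= a q.+1 * \sum_(j < q.+1) c ^+ j * a (p - j)%N.
  rewrite bE mulr_suml mulr_sumr; apply: ler_sum => j _.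
  have jq : (j <= q)%N by rewrite -ltnS.
  have := @log_concave_shift a j.+1 (q - j) (p - j) lca (leq_sub2r _ qp).
  rewrite !addnS !subnK ?(leq_trans jq) // => /(ler_wpM2l (exprn_ge0 j c0)).
  by rewrite -mulrA [X in _ -> _ <= X]mulrCA.
move=> /le_trans; apply; apply: ler_wpM2l => //.
rewrite bE -!(big_mkord xpredT (fun j => c ^+ j * a (p - j)%N)).
rewrite (@big_cat_nat _ _ _ q.+1 0 p.+1) //= lerDl.
by apply: sumr_ge0 => j _; rewrite mulr_ge0 ?exprn_ge0.
Qed.

End log_concave_theory.

(** * Cycle counts of permutations *)

Section permutations.
Import mathcomp.boot.fintype mathcomp.boot.finset.

(** With [y] the preimage of [x], composing with [tperm x y] makes [x] a fixed point, so what is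
    left moves only points of [D]. *)
Lemma big_perm_on_setU1 (T : finType) (V : nmodType) (x : T) (D : {set T})
    (F : {perm T} -> V) :
  x \notin D ->
  \sum_(s | perm_on (x |: D) s) F s =
  \sum_(y in x |: D) \sum_(s | perm_on D s) F (tperm x y * s)%g.
Proof.
move=> xD.
rewrite (partition_big (fun s : {perm T} => (s^-1)%g x) (mem (x |: D)))
  /=; last first.
  by move=> s sD; rewrite (perm_closed _ (perm_onV sD)) setU11.
apply: eq_bigr => y yD; rewrite (reindex_inj (mulgI (tperm x y))).
have tD : perm_on (x |: D) (tperm x y).
  apply: subset_trans (tperm_on x y) _.
  by apply/subsetP => z /set2P[]->//; exact: setU11.
apply: eq_bigl => s; apply/andP/idP => [[sD /eqP sx]|sD].
  have {}sD : perm_on (x |: D) s.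
    by have := perm_onM tD sD; rewrite mulgA tperm2 mul1g.
  have {}sx : s x = x.
    by have := congr1 (tperm x y * s)%g sx; rewrite permKV permM tpermR.
  apply/subsetP => z; rewrite inE => sz.
  have := subsetP sD z; rewrite inE sz !inE => /(_ isT)/predU1P[zx|//].
  by rewrite zx sx eqxx in sz.
have sx := out_perm sD xD; split.
  by apply: perm_onM tD (subset_trans sD (subsetUr _ _)).
by apply/eqP/(canLR (permK _)); rewrite permM tpermR sx.
Qed.

(** The fixed point [x] is a cycle of its own, which the transposition merges with the cycle of
    [y]. *)
Lemma card_porbits_mul_tperm_fix (T : finType) (s : {perm T}) (x y : T) :
  s x = x -> x != y -> (#|porbits (tperm x y * s)|.+1 = #|porbits s|)%N.
Proof.
move=> sx xy; have := porbits_mul_tperm s x y; rewrite xy.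
suff -> : x \notin porbit s y by rewrite -[true.*2]/2%N /= addn1 addn2 => -[].
rewrite porbit_sym; apply: contraNN xy => /porbitP[i ->].
by apply/eqP; elim: i => [|i IH]; rewrite ?expg0 ?perm1 // expgSr permM -IH.
Qed.

(* The [#|T| - #|D|] points outside [D] are fixed, so each contributes a factor
   ['X]; both sides are multiplied by ['X^#|D|] to avoid the subtraction. *)
Lemma porbits_perm_on_gf (R : idomainType) (T : finType) (D : {set T}) :
  'X^#|D| * \sum_(s | perm_on D s) 'X^#|porbits s| =
  'X^#|T| * \prod_(i < #|D|) ('X + i%:R) :> {poly R}.
Proof.
have [m] := ubnP #|D|; elim: m D => // m IH D; rewrite ltnS => Dm.
have [->|[x xD]] := set_0Vmem D.
  rewrite cards0 big_ord0 mul1r mulr1 (big_pred1 1%g) => [|s].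
    rewrite (_ : porbits 1 = [set [set x] | x : T]) ?card_imset //;
      first exact: set1_inj.
    apply: eq_imset => x; apply/setP => y; rewrite inE.
    apply/porbitP/eqP => [[i ->]|->]; first by rewrite expg1n perm1.
    by exists 0; rewrite expg0 perm1.
  by apply/idP/eqP => [sD|->]; rewrite ?perm_on1 // (perm_on_id sD) ?cards0.
have {IH} := IH (D :\ x); move: Dm.
rewrite (cardsD1 x) xD add1n => Dm /(_ Dm) IH.
rewrite -{2}(setD1K xD) big_perm_on_setU1 ?setD11 //.
rewrite big_setU1 ?setD11 //= tperm1 mulrDr big_ord_recr /= mulrA -IH.
under eq_bigr do rewrite mul1g.
set G := \sum_(s | _) _; set S := \sum_(y in _) _.
(* The term [y = x] is [G]; every other [y] merges two cycles, so ['X] times its sum is [G]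
   again. *)
have XS : 'X * S = G * #|D :\ x|%:R.
  rewrite mulr_natr -sumr_const mulr_sumr; apply: eq_bigr => y.
  rewrite !inE eq_sym => /andP[xy _].
  rewrite mulr_sumr; apply: eq_bigr => s sD.
  by rewrite -exprS card_porbits_mul_tperm_fix // (out_perm sD) // setD11.
by rewrite exprSr -!mulrA XS -mulrDr [in RHS]mulrDr [G * 'X]mulrC.
Qed.

End permutations.

(** * Adding one point to a set partition *)

Section partitions.
Import mathcomp.boot.fintype mathcomp.boot.finset.
Variables (T : finType) (x : T) (D : {set T}).
Hypothesis xD : x \notin D.
Implicit Types (Q : {set {set T}}) (B : {set T}).

(* [j.2 = set0] stands for adding the singleton block [[set x]]. *)
Let insert (j : {set {set T}} * {set T}) := (x |: j.2) |: (j.1 :\ j.2).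

(** When [x] is alone in its block, [A :\ x] is empty: it is kept as second component but removed
    from the family. *)
Let delete Q :=
  let A := pblock Q x in ((A :\ x |: Q :\ A) :\ set0, A :\ x).

Let insertable (j : {set {set T}} * {set T}) :=
  partition j.1 D && (j.2 \in set0 |: j.1).

Let insertK j :
  insertable j -> partition (insert j) (x |: D) && (delete (insert j) == j).
Proof.
case: j => Q B /andP[/= QD QB].
have Q0 := partition0 QD.
have nxQ A : x |: A \notin Q.
  apply: contraNN xD => /(partitionS QD)/subsetP; apply; exact: setU11.
have xB : x \notin B.
  case/setU1P: (QB) => [->|/(partitionS QD)/subsetP/(_ x)];
    first by rewrite inE.
  by move/contra; apply.
have QBD : partition (Q :\ B) (D :\: B).
  case/setU1P: QB => [->|]; last exact: partitionD1.
  by rewrite setD0 (setDidPl _) // disjoint_sym disjoints1 Q0.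
have BD : B \subset D.
  by case/setU1P: QB => [->|/(partitionS QD)//]; rewrite sub0set.
have ins : partition (insert (Q, B)) (x |: D).
  have -> : x |: D = x |: B :|: D :\: B.
    by rewrite -setUA -{1}(setIidPr BD) setID.
  apply: partitionU1 => //; first by apply/set0Pn; exists x; rewrite setU11.
  rewrite disjoint_sym disjoints_subset; apply/subsetP => y.
  rewrite !inE negb_or => /andP[-> yD]; rewrite andbT.
  by apply: contraNneq xD => <-.
rewrite ins /=.
have pb : pblock (insert (Q, B)) x = x |: B.
  by apply: def_pblock (partition_trivIset ins) _ _; rewrite setU11.
rewrite /delete pb /insert /= setU1K // setU1K; last first.
  by rewrite !inE (negbTE (nxQ B)) andbF.
apply/eqP; congr (_, _).
case/setU1P: QB => [->|QB].
  by rewrite setU1K ?setD11 // (setDidPl _) // disjoint_sym disjoints1 Q0.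
by rewrite setD1K // (setDidPl _) // disjoint_sym disjoints1 Q0.
Qed.

Let deleteK Q :
  partition Q (x |: D) -> insertable (delete Q) && (insert (delete Q) == Q).
Proof.
move=> QD; have Q0 := partition0 QD.
have xQ : x \in cover Q by rewrite (cover_partition QD) setU11.
have QA := pblock_mem xQ; have Ax : x \in pblock Q x by rewrite mem_pblock.
rewrite /delete; set A := pblock Q x in QA Ax *; set B := A :\ x.
have QAD := partitionD1 QD QA.
have QA0 : set0 \notin Q :\ A by rewrite !inE Q0 andbF.
(* [B] is a part of [A], from which the other blocks are disjoint, so adding [B] and removing it
   again gives back [Q :\ A]. *)
have QAB : B \notin Q :\ A.
  have [->//|/set0Pn[y yB]] := eqVneq B set0.
  apply: contraL (yB) => /(partitionS QAD)/subsetP/(_ y) yA.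
  by apply/negP => /[dup]/yA; rewrite !inE => /andP[/negbTE->]; rewrite andbF.
apply/andP; split; last first.
  rewrite /insert /= setD1K //; apply/eqP.
  rewrite -[RHS](setD1K QA); congr (_ |: _).
  apply/setP => C; rewrite !inE; have [->|_] /= := eqVneq C B.
    by apply/esym/negbTE; rewrite !inE in QAB.
  by have [->|//] /= := eqVneq C set0; rewrite Q0 andbF.
rewrite /insertable /=.
have AD : (x |: D) :\: A = D :\: B.
  apply/setP => y; rewrite !inE; have [->|//] := eqVneq y x.
  by rewrite Ax (negbTE xD).
have [B0|B0] := eqVneq B set0.
  by rewrite B0 setU1K // setU11 andbT -(setD0 D) -B0 -AD.
have BD : B \subset D.
  apply/subsetP => y; rewrite !inE => /andP[yx yA].
  by have := subsetP (partitionS QD QA) y yA; rewrite !inE (negbTE yx).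
have pB : partition (B |: Q :\ A) D.
  rewrite -(setID D B) (setIidPr BD) -AD; apply: partitionU1 => //.
  by rewrite AD disjoint_sym disjoints_subset subsetDr.
rewrite (setDidPl _); last by rewrite disjoint_sym disjoints1 (partition0 pB).
by rewrite pB !inE eqxx orbT.
Qed.

(** [insert] and [delete] are mutually inverse: the new point either forms its own block, in one
    way, or joins one of the [#|Q|] blocks without changing their number. *)
Lemma sum_partition_setU1 (F : nat -> nat) :
  (\sum_(Q | partition Q (x |: D)) F #|Q| =
   \sum_(Q | partition Q D) (F #|Q|.+1 + #|Q| * F #|Q|))%N.
Proof.
rewrite (reindex_onto insert delete) => [|Q /deleteK/andP[_ /eqP]//].
rewrite (eq_bigl insertable) => [|j]; last first.
  apply/andP/idP => [[/deleteK/andP[+ _] /eqP]|/insertK/andP//].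
  by move=> + <-.
rewrite -(pair_big_dep (fun Q => partition Q D) (fun Q B => B \in set0 |: Q)
  (fun Q B => F #|insert (Q, B)|)) /=.
apply: eq_bigr => Q QD; have Q0 := partition0 QD.
have nxQ A : x |: A \notin Q.
  apply: contraNN xD => /(partitionS QD)/subsetP; apply; exact: setU11.
have cardi B : #|insert (Q, B)| = #|Q :\ B|.+1.
  by rewrite /insert cardsU1 !inE (negbTE (nxQ B)) andbF.
rewrite big_setU1 ?Q0 //= cardi (setDidPl _); last first.
  by rewrite disjoint_sym disjoints1 Q0.
congr (_ + _)%N; rewrite -sum_nat_const; apply: eq_bigr => B QB.
by rewrite cardi (cardsD1 B Q) QB.
Qed.

End partitions.

(** * Recurrence for the Stirling numbers of the second kind *)

Section stirling2_recurrence.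
Import mathcomp.boot.fintype mathcomp.boot.finset.

Fixpoint stirling2_rec (n k : nat) : nat :=
  match n, k with
  | 0, 0 => 1
  | n'.+1, k'.+1 => stirling2_rec n' k' + k * stirling2_rec n' k
  | _, _ => 0
  end.

(** Stated for any finite set [D], so that the induction can remove a point without relabelling. *)
Lemma sum_partition_card_eq (T : finType) (D : {set T}) (k : nat) :
  (\sum_(Q | partition Q D) (#|Q| == k) = stirling2_rec #|D| k)%N.
Proof.
have [m] := ubnP #|D|; elim: m D k => // m IH D k; rewrite ltnS => Dm.
have [->|[x xD]] := set_0Vmem D.
  rewrite (big_pred1 set0) => [|Q]; last by rewrite partition_set0.
  by rewrite !cards0; case: k.
rewrite -(setD1K xD).
rewrite (sum_partition_setU1 (D := D :\ x) _ (fun j => j == k)) ?setD11 //.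
have Dxm : (#|D :\ x| < m)%N by move: Dm; rewrite (cardsD1 x) xD.
rewrite cardsU1 setD11 add1n; case: k => [|k] /=.
  by apply: big1 => Q _; case: eqP => [->|_]; rewrite ?muln0.
rewrite big_split /= -!IH // big_distrr /=; congr (_ + _)%N.
(* Where the indicator is 1, the factor [#|Q|] equals [k.+1]. *)
by apply: eq_bigr => Q _; case: eqP => [->|]; rewrite ?muln0.
Qed.

Lemma stirling2E (n k : nat) : stirling2 n k = stirling2_rec n k.
Proof.
have := sum_partition_card_eq [set: 'I_n] k; rewrite cardsT card_ord => <-.
rewrite /stirling2 -sum1dep_card big_mkcondr /=.
by apply: eq_bigr => Q _; case: eqP.
Qed.

End stirling2_recurrence.

Lemma stirling2_rec_small (n k : nat) : (n < k)%N -> stirling2_rec n k = 0%N.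
Proof.
elim: n k => [|n IH] [|k] //=; rewrite ltnS => nk.
by rewrite !IH ?muln0 // ltnW.
Qed.

Arguments stirling2_rec : simpl never.

(** * Coefficients of rising factorials and of binomial powers *)

Lemma coef_prod_XaddC_stirling1 (R : idomainType) (n j : nat) :
  (\prod_(i < n) ('X + i%:R) : {poly R})`_j = (stirling1 n j)%:R.
Proof.
(* With [D] the whole set, both sides carry the factor ['X^n], which cancels. *)
have := porbits_perm_on_gf R [set: 'I_n].
rewrite cardsT card_ord => /(mulfI (monic_neq0 (monicXn R n))) <-.
rewrite coef_sum (eq_bigl xpredT) => [|s];
  last by apply/fintype.subsetP => y _; rewrite inE.
rewrite /stirling1 -sum1dep_card natr_sum [RHS]big_mkcond /=.
by apply: eq_bigr => s _; rewrite coefXn eq_sym; case: eqP.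
Qed.

Lemma coef_XaddC_exp (R : comNzRingType) (r : R) (n k : nat) :
  (('X + r%:P) ^+ n)`_k = 'C(n, k)%:R * r ^+ (n - k).
Proof.
rewrite addrC exprDn coef_sum.
under eq_bigr do rewrite coefMn -rmorphXn coefCM coefXn.
have [kn|nk] := ltnP k n.+1; last first.
  rewrite bin_small // mul0r big1 // => i _.
  by rewrite gtn_eqF ?mulr0 ?mul0rn // (leq_trans (ltn_ord i)).
rewrite (bigD1 (Ordinal kn)) //= eqxx mulr1 big1 ?addr0 ?mulr_natl // => i ik.
by rewrite eq_sym -val_eqE in ik; rewrite (negbTE ik) mulr0 mul0rn.
Qed.

(** * Rows and columns of r-Stirling numbers *)

Section rstirling.
Variables (R : realType) (r : R).

(** Substituting ['X + r] into the rising factorial and expanding each power by the binomial theorem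
    gives the defining sum. *)
Lemma rstirling1E (n k : nat) :
  rstirling1 r n k = (\prod_(i < n) ('X + (r + i%:R)%:P))`_k.
Proof.
pose p : {poly R} := \prod_(i < n) ('X + i%:R).
have sp : size p = n.+1.
  rewrite /p; under eq_bigr do rewrite -[_%:R]opprK -polyC_natr -polyCN.
  by rewrite size_prod_XsubC /index_enum -enumT size_enum_ord.
have -> : \prod_(i < n) ('X + (r + i%:R)%:P) = p \Po ('X + r%:P).
  rewrite /p rmorph_prod; apply: eq_bigr => i _.
  by rewrite /= comp_polyD comp_polyX -polyC_natr comp_polyC polyCD addrA.
rewrite comp_polyE sp coef_sum /rstirling1 big_geq_mkord big_mkcond /=.
apply: eq_bigr => j _.
rewrite coefZ coef_XaddC_exp coef_prod_XaddC_stirling1 mulrA.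
by case: leqP => // jk; rewrite bin_small // mulr0 mul0r.
Qed.

Lemma rstirling1_log_concave (n : nat) :
  0 <= r -> log_concave (rstirling1 r n).
Proof.
move=> r0; elim: n => [|n IH].
  split=> [i|q p _]; rewrite !rstirling1E !big_ord0 !coef1 //=.
  by rewrite mulr0 mulr_ge0.
apply: (@log_concave_affine_mul _ (rstirling1 r n) _ (r + n%:R)) => //.
  by rewrite addr_ge0.
move=> i; rewrite rstirling1E big_ord_recr /= mulrC mulrDl coefD coefXM coefCM.
by rewrite rstirling1E; case: i => [|i] //=; rewrite rstirling1E.
Qed.

(** Starting the sum at 0 makes its range independent of [k], so that sums for different [k] can be
    combined term by term. *)
Lemma rstirling2E (n k : nat) :
  rstirling2 r n k =
  \sum_(j < n.+1) 'C(n, j)%:R * (stirling2_rec j k)%:R * r ^+ (n - j).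
Proof.
rewrite /rstirling2 big_geq_mkord big_mkcond /=.
apply: eq_bigr => j _; rewrite stirling2E.
by case: leqP => // jk; rewrite stirling2_rec_small // mulr0 mul0r.
Qed.

Lemma rstirling2_0 (k : nat) : rstirling2 r 0 k = (k == 0%N)%:R.
Proof. by rewrite rstirling2E big_ord1 bin0 mulr1 mul1r; case: k. Qed.

(** Pascal's rule splits ['C(n.+1, j.+1)]; the part with ['C(n, j.+1)], together with the term of
    index 0, is [r] times the previous sum. *)
Lemma rstirling2S (n k : nat) :
  rstirling2 r n.+1 k = r * rstirling2 r n k +
  \sum_(j < n.+1) 'C(n, j)%:R * (stirling2_rec j.+1 k)%:R * r ^+ (n - j).
Proof.
rewrite !rstirling2E big_ord_recl.
under eq_bigr do rewrite lift0 binS natrD !mulrDl subSS.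
rewrite big_split /= addrA; congr (_ + _).
rewrite [X in _ + X = _]big_ord_recr /= (bin_small (ltnSn n)) !mul0r addr0.
rewrite [X in r * X]big_ord_recl mulrDr !bin0 !mul1r !subn0 mulrCA -exprS.
congr (_ + _); rewrite mulr_sumr; apply: eq_bigr => j _; rewrite lift0 mulrCA -exprS.
by rewrite subnSK.
Qed.

Lemma rstirling2S0 (n : nat) : rstirling2 r n.+1 0 = r * rstirling2 r n 0.
Proof. by rewrite rstirling2S big1 ?addr0 // => j _; rewrite mulr0 mul0r. Qed.

Lemma rstirling2SS (n k : nat) :
  rstirling2 r n.+1 k.+1 =
  rstirling2 r n k + (r + k.+1%:R) * rstirling2 r n k.+1.
Proof.
rewrite rstirling2S mulrDl addrCA; congr (_ + _).
rewrite !rstirling2E mulr_sumr -big_split; apply: eq_bigr => j _ /=.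
rewrite /stirling2_rec -/stirling2_rec natrD natrM; lra.
Qed.

Lemma rstirling2_log_concave (k : nat) :
  0 <= r -> log_concave (rstirling2 r ^~ k).
Proof.
move=> r0; elim: k => [|k IH].
  (* Column 0 consists of the powers of [r], generated from the sequence 1, 0, 0, and so on. *)
  apply: (@log_concave_geometric _ (fun i => (i == 0%N)%:R) _ r) => //.
  - split=> [i|q p _] //=; by rewrite mulr0 mulr_ge0.
  - by rewrite rstirling2_0.
  - by move=> i; rewrite rstirling2S0 add0r.
apply: (log_concave_geometric (c := r + k.+1%:R) _ (log_concave_delay IH)).
- by rewrite addr_ge0.
- by rewrite rstirling2_0.
- by move=> i; rewrite rstirling2SS.
Qed.

End rstirling.

(** * Log-concavity of the r-Lah distribution *)

Local Open Scope classical_set_scope.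

Theorem proposition3p14 (R : realType) (n k : nat) (r : R)
    (d : measure_display) (T : measurableType d) (P : probability T R)
    (X : {RV P >-> nat}) (i : nat) :
  rlah_admissible n k r ->
  rlah_distributed X n k r ->
  (k.+1 <= i <= n.-1)%N ->
  (P (X @^-1` [set i.-1]) * P (X @^-1` [set i.+1])
     <= P (X @^-1` [set i]) ^+ 2)%E.
Proof.
case=> [n0 _ r0 _] XE; case: i => // i; rewrite ltnS => /andP[ki].
rewrite -ltnS (ltn_predK n0) => iN /=.
rewrite !XE ?ki ?iN ?(leqW ki) ?(leqW (leqW ki)) ?(ltnW iN)
  ?(ltnW (ltnW iN)) //.
(* Both sides contain the square of the normalizing constant, so it remains to compare products of
   r-Stirling numbers. *)
rewrite -!EFinM lee_fin mulrACA [leRHS]mulrACA.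
have [a0 /(_ i i.+1 (leqnSn i)) lca] := rstirling1_log_concave n r0.
have [b0 /(_ i i.+1 (leqnSn i)) lcb] := rstirling2_log_concave k r0.
apply: ler_wpM2l; first by rewrite -expr2 sqr_ge0.
by rewrite mulrACA [leRHS]mulrACA ler_pM ?mulr_ge0.
Qed.
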